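(* Let $d\ge 1$, let $\vartheta>0$, and let $\Phi(N,n)$ be complex weights ($N\ge 1$ integer, $n\in\mathbb Z$) such that for every $N$ the function $n\mapsto\Phi(N,n)$ has bounded support and $\sum_{n=-\infty}^{+\infty}\Phi(N,n)=1$. For $t\in\mathbb R$ set $$C(t)=\limsup_{N\to+\infty}\left\{N^{\vartheta}\left|\sum_{n=-\infty}^{+\infty}\Phi(N,n)e^{2\pi i n t}\right|\right\}\in[0,+\infty].$$ Then for every integrable function $f$ on $\mathbb T^d$, every $m\in\mathbb Z^d\setminus\{0\}$ and every $\alpha\in\mathbb T^d$, $$\limsup_{N\to+\infty}\left\{N^{\vartheta}\sup_{x\in\mathbb T^d}\left|\mathcal D_N^{\Phi,\alpha}f(x)\right|\right\}\ge C(m\cdot\alpha)\,|\widehat f(m)|$$ (with the convention $(+\infty)\cdot 0=0$).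
   Context: $\mathbb T^d=\mathbb R^d/\mathbb Z^d$; functions on $\mathbb T^d$ are identified with $\mathbb Z^d$-periodic functions on $\mathbb R^d$. Fourier coefficients: $\widehat f(m)=\int_{\mathbb T^d}f(x)e^{-2\pi i m\cdot x}dx$, $m\in\mathbb Z^d$. The weighted discrepancy is $$\mathcal D_N^{\Phi,\alpha}f(x)=\sum_{n=-\infty}^{+\infty}\Phi(N,n)f(x+n\alpha)-\int_{\mathbb T^d}f(y)\,dy .$$ $C(t)$ is $1$-periodic, so $C(m\cdot\alpha)$ is well defined for $\alpha\in\mathbb T^d$. *)

(* Defs.v *)
From HB Require Import structures.
From mathcomp Require Import all_boot all_order all_algebra.
From mathcomp Require Import all_classical all_reals all_analysis.
From mathcomp Require Import complex.
Import Order.TTheory GRing.Theory Num.Theory.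
Import numFieldNormedType.Exports.

Set Implicit Arguments.
Unset Strict Implicit.
Unset Printing Implicit Defensive.

Local Open Scope classical_set_scope.
Local Open Scope ring_scope.
Local Open Scope complex_scope.

Definition rV_display : measure_display -> measure_display.
Proof. exact. Qed.

(* The product sigma-algebra on row vectors, generated by the coordinates (for
   entries in R : realType these are the Borel sets of R^n). *)
Section measurable_rV.
Context {d : measure_display} {T : measurableType d} (n : nat).

Definition coord_rV (i : 'I_n) (x : 'rV[T]_n) : T := x ord0 i.

Let rV_set0 : g_sigma_preimage coord_rV set0.
Proof. exact: sigma_algebra0. Qed.

Let rV_setC A : g_sigma_preimage coord_rV A -> g_sigma_preimage coord_rV (~` A).
Proof. exact: sigma_algebraC. Qed.

Let rV_bigcup (F : (set 'rV[T]_n)^nat) :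
  (forall i, g_sigma_preimage coord_rV (F i)) ->
  g_sigma_preimage coord_rV (\bigcup_i (F i)).
Proof. exact: sigma_algebra_bigcup. Qed.

HB.instance Definition _ := @isMeasurable.Build (rV_display d)
  'rV[T]_n (g_sigma_preimage coord_rV) rV_set0 rV_setC rV_bigcup.

End measurable_rV.

Lemma measurable_fun_rVP (d d' : measure_display) (T1 : measurableType d)
    (T2 : measurableType d') (n : nat) (f : T1 -> 'rV[T2]_n) :
  measurable_fun setT f <->
  (forall i, measurable_fun setT (fun x => f x ord0 i)).
Proof.
have coordE i (B : set T2) : measurable B ->
    measurable ((fun y : 'rV[T2]_n => y ord0 i) @^-1` B).
  move=> mB; apply: sub_sigma_algebra => /=.
  rewrite -bigcup_seq/=; exists i => /=; first by rewrite mem_index_enum.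
  by exists B => //; rewrite setTI.
split=> [mf i _ B mB|mf].
  by rewrite setTI; have := mf measurableT _ (coordE i B mB); rewrite setTI.
pose F (A : set 'rV[T2]_n) := measurable (f @^-1` A).
move=> _ A mA; rewrite setTI; rewrite -/(F A).
apply: (mA F); split; first split.
- by rewrite /F preimage_set0; exact: measurable0.
- move=> B FB; rewrite /F setTD preimage_setC; exact: measurableC.
- by move=> B FB; rewrite /F preimage_bigcup; exact: bigcupT_measurable.
move=> B; rewrite -bigcup_seq/= => -[i _ [C mC <-]].
by have := mf i measurableT C mC; rewrite /F !setTI.
Qed.

Section lebesgue_rV.
Context {R : realType}.

(* Lebesgue measure on R^(n+1): the product of the one-dimensional Lebesgue
   measure and of m on R^n, carried over by (t, v) |-> row_mx t v. *)
Section step.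
Variable n : nat.

Definition cons_rV (p : measurableTypeR R * 'rV[R]_n) : 'rV[R]_n.+1 :=
  row_mx (const_mx (p.1 : R) : 'rV_1) p.2.

Lemma measurable_cons_rV : measurable_fun setT cons_rV.
Proof.
apply/measurable_fun_rVP => i; rewrite /cons_rV.
have [[j ->]|[j ->]] : (exists j, i = @lshift 1 n j) \/ (exists j, i = @rshift 1 n j).
  by case: (@split_ordP 1 n i) => j ->; [left|right]; exists j.
- rewrite (_ : (fun _ => _) = fst); first exact: measurable_fst.
  by apply/funext => p; rewrite (@row_mxEl _ 1 1 n) mxE.
- have mj : measurable_fun setT (fun v : 'rV[R]_n => v ord0 j).
    exact: (measurable_fun_rVP _).1 (@measurable_id _ 'rV[R]_n setT) j.
  rewrite (_ : (fun _ => _) = (fun v : 'rV[R]_n => v ord0 j) \o snd).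
    exact: (measurableT_comp mj measurable_snd).
  by apply/funext => p; rewrite (@row_mxEr _ 1 1 n).
Qed.

Let uncons (v : 'rV[R]_n.+1) : measurableTypeR R * 'rV[R]_n :=
  ((v : 'rV_(1 + n)) ord0 (lshift n ord0), rsubmx (v : 'rV_(1 + n))).

Let consK : cancel cons_rV uncons.
Proof.
move=> [t v]; rewrite /uncons /cons_rV /= (@row_mxEl _ 1 1 n) mxE.
by rewrite (@row_mxKr _ 1 1 n).
Qed.

Let measurable_uncons : measurable_fun setT uncons.
Proof.
have mcoord k : measurable_fun setT (fun v : 'rV[R]_n.+1 => v ord0 k).
  exact: (measurable_fun_rVP _).1 (@measurable_id _ 'rV[R]_n.+1 setT) k.
apply: measurable_fun_pair; first exact: mcoord.
apply/measurable_fun_rVP => k; under eq_fun do rewrite mxE; exact: mcoord.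
Qed.

Variable m : {sigma_finite_measure set 'rV[R]_n -> \bar R}.

Definition lebesgue_rV_step : set 'rV[R]_n.+1 -> \bar R :=
  pushforward (lebesgue_measure \x m)%E cons_rV.

Let step0 : lebesgue_rV_step set0 = 0%E.
Proof. by rewrite /lebesgue_rV_step /pushforward preimage_set0 measure0. Qed.

Let step_ge0 A : (0 <= lebesgue_rV_step A)%E.
Proof. by apply: integral_ge0 => t _; exact: measure_ge0. Qed.

Let step_sigma_additive : semi_sigma_additive lebesgue_rV_step.
Proof.
pose mu : {measure set (measurableTypeR R * 'rV[R]_n)%type -> \bar R} :=
  (lebesgue_measure \x m)%E.
move=> F mF tF mUF.
have mcons := measurable_cons_rV.
rewrite /lebesgue_rV_step /pushforward preimage_bigcup.
apply: (@measure_semi_sigma_additive _ _ _ mu).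
- by move=> k; rewrite -[X in measurable X]setTI; exact: mcons.
- apply/trivIsetP => /= a b _ _ ab; rewrite -preimage_setI.
  by move/trivIsetP : tF => /(_ _ _ _ _ ab) ->//; rewrite preimage_set0.
- by rewrite -preimage_bigcup -[X in measurable X]setTI; exact: mcons.
Qed.

HB.instance Definition _ := isMeasure.Build _ _ _ lebesgue_rV_step
  step0 step_ge0 step_sigma_additive.

Let step_sigma_finite : sigma_finite setT lebesgue_rV_step.
Proof.
pose leb : {sigma_finite_measure set (measurableTypeR R) -> \bar R} :=
  @lebesgue_measure R.
have /sigma_finiteP[F [TF ndF Foo]] := sigma_finiteT leb.
have /sigma_finiteP[G [TG ndG Goo]] := sigma_finiteT m.
exists (fun k => uncons @^-1` (F k `*` G k)) => [|k].
  rewrite -preimage_bigcup; apply/esym; rewrite -subTset => v _ /=.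
  have [a _ Fa] : (\bigcup_k F k) (uncons v).1 by rewrite -TF.
  have [b _ Gb] : (\bigcup_k G k) (uncons v).2 by rewrite -TG.
  exists (maxn a b) => //; split.
  - by move: Fa; exact/subsetPset/ndF/leq_maxl.
  - by move: Gb; exact/subsetPset/ndG/leq_maxr.
have [mF Fk] := Foo k; have [mG Gk] := Goo k; split.
  rewrite -[X in measurable X]setTI.
  by apply: measurable_uncons => //; exact: measurableX.
rewrite /lebesgue_rV_step /pushforward -comp_preimage.
rewrite (_ : uncons \o cons_rV = id); last first.
  by apply/funext => p; exact: consK.
rewrite preimage_id (@product_measure1E _ _ (measurableTypeR R) _ _ leb)//.
by rewrite lte_mul_pinfty// ge0_fin_numE.
Qed.

HB.instance Definition _ := Measure_isSigmaFinite.Build _ _ _ lebesgue_rV_step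
  step_sigma_finite.

End step.

Fixpoint lebesgue_rV (n : nat) :
    {sigma_finite_measure set 'rV[R]_n -> \bar R} :=
  if n is n'.+1 then lebesgue_rV_step (lebesgue_rV n')
  else \d_(0 : 'rV[R]_0).

End lebesgue_rV.

Lemma lebesgue_rV_box (R : realType) (n : nat) (A : 'I_n -> set R) :
  (forall i, measurable (A i)) ->
  lebesgue_rV n [set x : 'rV[R]_n | forall i, A i (x ord0 i)] =
  (\prod_(i < n) lebesgue_measure (A i))%E.
Proof.
elim: n A => [|n IH] A mA.
  by rewrite big_ord0 /= diracE mem_set// => -[].
rewrite big_ord_recl -(IH (fun i => A (lift ord0 i)))//=.
rewrite /lebesgue_rV_step /pushforward.
pose B := [set x : 'rV[R]_n | forall i, A (lift ord0 i) (x ord0 i)].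
have mB : measurable B.
  rewrite (_ : B = \bigcap_(i in [set: 'I_n])
    ((fun x : 'rV[R]_n => x ord0 i) @^-1` (A (lift ord0 i)))).
    apply: fin_bigcap_measurable => // i _; rewrite -[X in measurable X]setTI.
    by apply: ((measurable_fun_rVP _).1 (@measurable_id _ 'rV[R]_n setT) i).
  by apply/seteqP; split => x h i; [move=> _; exact: h|exact: (h i I)].
rewrite -(@product_measure1E _ _ (measurableTypeR R) _ _ (@lebesgue_measure R)
  (lebesgue_rV n) (A ord0) B)//.
congr (_ _).
have e0 : @lshift 1 n ord0 = (ord0 : 'I_n.+1) by exact/val_inj.
have eS i : @rshift 1 n i = (lift ord0 i : 'I_n.+1) by exact/val_inj.
have c0 t v : (cons_rV (t, v) : 'rV[R]_n.+1) ord0 ord0 = t.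
  by rewrite -e0 /cons_rV (@row_mxEl _ 1 1 n) mxE.
have cS t v i : (cons_rV (t, v) : 'rV[R]_n.+1) ord0 (lift ord0 i) = v ord0 i.
  by rewrite -eS /cons_rV (@row_mxEr _ 1 1 n).
apply/seteqP; split => -[t v] /=.
  by move=> h; split => [|i] /=; [rewrite -(c0 t v)|rewrite -(cS t v)]; exact: h.
move=> [h1 h2] i; case: (unliftP ord0 i) => [k ->|->]; first by rewrite cS; exact: h2.
by rewrite c0; exact: h1.
all: exact: (mA ord0).
Qed.

(* R^n with the Lebesgue-measurable (not only Borel) sets: the Caratheodory
   sigma-algebra of the Lebesgue outer measure. *)
Definition lebesgue_rV_type (R : realType) (n : nat) : measurableType _ :=
  caratheodory_type (mu_ext (@lebesgue_rV R n)).

Definition completed_lebesgue_rV (R : realType) (n : nat) :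
    {measure set (lebesgue_rV_type R n) -> \bar R} :=
  @completed_measure_extension _ _ _ (@lebesgue_rV R n).

Section torus.
Context {R : realType} {d : nat}.
Implicit Types (f : 'rV[R]_d -> R[i]) (x alpha : 'rV[R]_d) (m : 'rV[int]_d).

(* A function on the torus R^d / Z^d is a Z^d-periodic function on R^d, and it is
   integrated over the fundamental domain [0, 1)^d. *)
Definition periodic_rV f := forall x m, f (x + map_mx intr m) = f x.

Definition unit_cube : set (lebesgue_rV_type R d) :=
  [set x : 'rV[R]_d | forall i, 0 <= x ord0 i < 1].

Definition torus_integrable f :=
  (completed_lebesgue_rV R d).-integrable unit_cube
    (EFin \o (fun x : lebesgue_rV_type R d => complex.Re (f x))) /\
  (completed_lebesgue_rV R d).-integrable unit_cube
    (EFin \o (fun x : lebesgue_rV_type R d => complex.Im (f x))).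

Definition torus_integral f : R[i] :=
  (\int[completed_lebesgue_rV R d]_(x in unit_cube) complex.Re (f x)) +i*
  (\int[completed_lebesgue_rV R d]_(x in unit_cube) complex.Im (f x)).

Definition normc (z : R[i]) : R := complex.Re `|z|.

(* e^{2 pi i t} *)
Definition expi2pi (t : R) : R[i] := cos (2 * pi * t) +i* sin (2 * pi * t).

Definition int_dot m x : R := \sum_(i < d) (m ord0 i)%:~R * x ord0 i.

Definition fourier_coef f m : R[i] :=
  torus_integral (fun x => f x * expi2pi (- int_dot m x)).

Implicit Type Phi : nat -> int -> R[i].

(* The sums over Z are finite, by the bounded support of Phi N. *)
Definition discrepancy Phi alpha f (N : nat) x : R[i] :=
  \sum_(n \in [set: int]) Phi N n * f (x + n%:~R *: alpha) - torus_integral f.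

Definition weight_limsup Phi (theta t : R) : \bar R :=
  limn_esup (fun N => (N%:R `^ theta *
    normc (\sum_(n \in [set: int]) Phi N n * expi2pi (n%:~R * t)))%:E).

Definition discrepancy_limsup Phi (theta : R) alpha f : \bar R :=
  limn_esup (fun N => ((N%:R `^ theta)%:E *
    ereal_sup [set (normc (discrepancy Phi alpha f N x))%:E | x in setT])%E).

End torus.

(* Main.v *)
(* For m != 0 the m-th Fourier coefficient of the discrepancy D_N f equals
   (sum_n Phi(N,n) e^{2 pi i n m.alpha}) * fhat(m): translation by n alpha
   multiplies fhat(m) by e^{2 pi i n m.alpha}, and the constant term has no m-th
   coefficient.  A Fourier coefficient is at most the supremum of the function,
   so the bound holds for each N >= 1 and passes to the limsup.

   The analytic input is that integration over [0, 1)^d is invariant under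
   translation of periodic functions.  Modulo Z^d a translation is the
   coordinatewise rotation [torus_shift] of the cube; it preserves the
   volume of boxes, hence the Borel measure, hence (being bijective) the outer
   measure and the Caratheodory sigma-algebra. *)
Require Import Defs.
From mathcomp Require Import all_boot all_order all_algebra.
From mathcomp Require Import all_classical all_reals all_analysis.
From mathcomp Require Import measurable_realfun complex lra ring zify.
Import Order.TTheory GRing.Theory Num.Theory.
Import numFieldNormedType.Exports.

Local Open Scope classical_set_scope.
Local Open Scope ring_scope.
Local Open Scope complex_scope.

(** * Translations of the line and rotations of the circle *)

Lemma lebesgue_measure_translation (R : realType) (c : R) (A : set R) :
  measurable A ->
  lebesgue_measure ((fun t : R => t + c) @^-1` A) = lebesgue_measure A.
Proof.
move=> mA; apply/esym.
pose tr (t : measurableTypeR R) : measurableTypeR R := t + c.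
have mtr : measurable_fun setT tr by exact: measurable_funD.
(* Lebesgue measure is determined by its values on half-open intervals, so only the preimages of
   these need computing. *)
apply: (lebesgue_measure_unique (mu := pushforward lebesgue_measure tr)) => //=.
move=> _ [[a b]] _ <-.
rewrite /pushforward.
have -> : (fun t : R => t + c) @^-1` `]a, b] = `](a - c), (b - c)]%classic.
  by apply/seteqP; split => t /=; rewrite !in_itv/=; lra.
rewrite !lebesgue_measure_itv/= !lte_fin ltrD2r.
by case: ifP => // _; rewrite -!EFinD; congr (_%:E); lra.
Qed.

(* The rotation t |-> t + a of [0, 1) = R / Z, extended by the identity outside
   [0, 1) so that it preserves Lebesgue measure on all of R; its inverse is the
   rotation by 1 - a. *)
Definition circle_shift {R : realType} (a t : R) : R :=
  if (0 <= t) && (t < 1 - a) then t + a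
  else if (1 - a <= t) && (t < 1) then t + (a - 1) else t.

Lemma measurable_circle_shift (R : realType) (a : R) :
  measurable_fun setT (circle_shift a : R -> R).
Proof.
have mand (b c : R) :
    measurable_fun setT (fun t : R => (b <= t) && (t < c) : bool).
  apply: measurable_and; first exact: measurable_fun_ler.
  exact: measurable_fun_ltr.
apply: measurable_fun_ifT => //; first exact: measurable_funD.
by apply: measurable_fun_ifT => //; exact: measurable_funD.
Qed.

Lemma circle_shift_unit (R : realType) (a t : R) : 0 <= a <= 1 ->
  (0 <= circle_shift a t < 1) = (0 <= t < 1).
Proof.
move=> /andP[a0 a1]; rewrite /circle_shift; case: ifP => [/andP[? ?]|_].
  by apply/idP/idP => /andP[? ?]; apply/andP; split; lra.
case: ifP => [/andP[? ?]|_] //.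
by apply/idP/idP => /andP[? ?]; apply/andP; split; lra.
Qed.

(** The closed range for [a] is stable under [a |-> 1 - a], so every statement about rotations
    applies to their inverses as well. *)
Lemma circle_shiftK (R : realType) (a : R) : 0 <= a <= 1 ->
  cancel (circle_shift a) (circle_shift (1 - a)).
Proof.
move=> /andP[a0 a1] t; rewrite /circle_shift.
have [t0|t0] := leP 0 t; have [t1|t1] := ltP t (1 - a);
  have [t2|t2] := ltP t 1 => //=; repeat (case: ifP => /=); lra.
Qed.

(** The map is piecewise a translation: [A] is cut into three disjoint pieces, each preimage is a
    translate of its piece, and additivity reassembles them. *)
Lemma lebesgue_measure_circle_shift (R : realType) (a : R) (A : set R) :
  0 <= a <= 1 -> measurable A ->
  lebesgue_measure (circle_shift a @^-1` A) = lebesgue_measure A.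
Proof.
move=> /andP[a0 a1] mA.
pose tr (c : R) (B : set R) := (fun t : R => t + c) @^-1` B.
have mtr c B : measurable B -> measurable (tr c B).
  move=> mB; rewrite /tr -[X in measurable X]setTI.
  have /(_ measurableT _ mB) : measurable_fun setT (fun t : R => t + c).
    exact: measurable_funD.
  exact.
(* [J1] is the image of [[0, 1 - a)] under translation by [a], [J2] that of [[1 - a, 1)] under
   translation by [a - 1]; on [J3] the map is the identity. *)
pose J1 : set R := `[a, 1[%classic; pose J2 : set R := `[0, a[%classic.
pose J3 : set R := ~` `[0, 1[%classic.
have mJ1 : measurable J1 by exact: measurable_itv.
have mJ2 : measurable J2 by exact: measurable_itv.
have mJ3 : measurable J3 by exact: measurableC.
have -> : circle_shift a @^-1` A =
    (tr a (A `&` J1) `|` tr (a - 1) (A `&` J2)) `|` (A `&` J3).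
  apply/seteqP; split => t; rewrite /tr /J1 /J2 /J3 /circle_shift /=
    !in_itv/=; case: ifP => [/andP[h1 h2]|h1].
  - by move=> At; left; left; split => //; lra.
  - case: ifP => [/andP[h2 h3] At|h2 At].
      by left; right; split => //; lra.
    by right; split => //; apply/negP; lra.
  - by case=> [[[]//|[_ h3]]|[_ /negP h3]]; exfalso; lra.
  - case: ifP => [/andP[h2 h3]|h2].
      by case=> [[[_ h4]|[]//]|[_ /negP h4]]; exfalso; lra.
    by case=> [[[_ h4]|[_ h4]]|[]//]; exfalso; lra.
have tU B C (mB : measurable B) (mC : measurable C) : B `&` C = set0 ->
    (lebesgue_measure (B `|` C : set R) =
     lebesgue_measure B + lebesgue_measure C)%E.
  by move=> BC; rewrite measureU.
rewrite !tU; first 1 last.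
- by apply: mtr; exact: measurableI.
- by apply: mtr; exact: measurableI.
- apply/seteqP; split => t //; rewrite /tr /J1 /J2 /= !in_itv/= => -[[_ h1] [_ h2]].
  by exfalso; lra.
- by apply: measurableU; apply: mtr; exact: measurableI.
- exact: measurableI.
- apply/seteqP; split => t //; rewrite /tr /J1 /J2 /J3 /= !in_itv/=.
  by case=> [[[_ h1]|[_ h1]] [_ /negP h2]]; exfalso; lra.
rewrite !lebesgue_measure_translation; [|exact: measurableI|exact: measurableI].
rewrite -!tU; first 1 last.
- by apply: measurableU; exact: measurableI.
- exact: measurableI.
- apply/seteqP; split => t //; rewrite /J1 /J2 /J3 /= !in_itv/=.
  by case=> [[[_ h1]|[_ h1]] [_ /negP h2]]; exfalso; lra.
- exact: measurableI.
- exact: measurableI.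
- apply/seteqP; split => t //; rewrite /J1 /J2 /= !in_itv/= => -[[_ h1] [_ h2]].
  by exfalso; lra.
congr (lebesgue_measure _); rewrite -!setIUr; apply/setIidPl => t _.
rewrite /J1 /J2 /J3 /= !in_itv/=.
have [t0|t0] := leP 0 t; have [t1|t1] := ltP t a; have [t2|t2] := ltP t 1 => /=;
  by [left; left|left; right|right].
Qed.

(** * Coordinatewise rotations preserve the completed Lebesgue measure *)

Section torus_shift.
Context {R : realType} {d : nat}.
Implicit Types (a x : 'rV[R]_d).

Definition torus_shift a x : 'rV[R]_d :=
  \row_i circle_shift (a ord0 i) (x ord0 i).

Definition rV_box (B : 'I_d -> set R) : set 'rV[R]_d :=
  [set x | forall i, B i (x ord0 i)].

Lemma measurable_coord_rV (i : 'I_d) :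
  measurable_fun setT (fun x : 'rV[R]_d => x ord0 i).
Proof. exact: (measurable_fun_rVP _).1 (@measurable_id _ 'rV[R]_d setT) i. Qed.

Lemma measurable_rV_box (B : 'I_d -> set R) :
  (forall i, measurable (B i)) -> measurable (rV_box B).
Proof.
move=> mB; rewrite (_ : rV_box B = \bigcap_(i in [set: 'I_d])
    ((fun x : 'rV[R]_d => x ord0 i) @^-1` (B i))).
  apply: fin_bigcap_measurable => // i _; rewrite -[X in measurable X]setTI.
  exact: measurable_coord_rV.
by apply/seteqP; split => x h i; [move=> _; exact: h|exact: (h i I)].
Qed.

Lemma measurable_torus_shift a : measurable_fun setT (torus_shift a).
Proof.
apply/measurable_fun_rVP => i; under eq_fun do rewrite mxE.
exact: measurableT_comp (measurable_circle_shift _ _) (measurable_coord_rV i).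
Qed.

(** Boxes, unlike single-coordinate preimages, are stable under intersection, as uniqueness of
    measures requires. A coordinate preimage is a box whose other sides are the whole line. *)
Lemma measurable_rVE :
  @measurable _ 'rV[R]_d =
  <<s [set rV_box B | B in [set B | forall i, measurable (B i)]] >>.
Proof.
apply/seteqP; split; last first.
  apply: smallest_sub; first exact: sigma_algebra_measurable.
  by move=> _ [B mB <-]; exact: measurable_rV_box.
apply: smallest_sub; first exact: smallest_sigma_algebra.
move=> A; rewrite -bigcup_seq/= => -[i _ [C mC <-]].
apply: sub_sigma_algebra; exists (fun j => if j == i then C else setT).
  by move=> j /=; case: ifP.
apply/seteqP; split => x /=; first by move=> /(_ i); rewrite eqxx.
by move=> [_ Cx] j; case: eqP => // ->.
Qed.

(** The two measures agree on boxes, by the product formula and the one-dimensional case, and open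
    cubes of finite volume exhaust the space; uniqueness on a generating pi-system concludes. *)
Lemma lebesgue_rV_torus_shift a (A : set 'rV[R]_d) :
  (forall i, 0 <= a ord0 i <= 1) -> measurable A ->
  lebesgue_rV d (torus_shift a @^-1` A) = lebesgue_rV d A.
Proof.
move=> a01 mA.
pose mu : {measure set 'rV[R]_d -> \bar R} := lebesgue_rV d.
apply: (measure_unique [set rV_box B | B in [set B | forall i, measurable (B i)]]
  (fun k => rV_box (fun=> `](- k%:R), k%:R[%classic))
  _ _ _ _ (pushforward mu (torus_shift a)) mu) => //.
- exact: measurable_rVE.
- move=> _ _ [B mB <-] [C mC <-]; exists (fun i => B i `&` C i).
    by move=> i; exact: measurableI.
  apply/seteqP; split => x /= => [h|[h1 h2] i]; last by split.
  by split=> i; have [] := h i.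
- by move=> k; exists (fun=> `](- k%:R), k%:R[%classic).
- apply/seteqP; split => // x _.
  have [k xk] : exists k : nat, forall i, `|x ord0 i| < k%:R.
    exists (Num.bound (\sum_i `|x ord0 i|)) => i.
    apply: le_lt_trans (archi_boundP _); last exact: sumr_ge0.
    by rewrite (bigD1 i)//= lerDl sumr_ge0.
  by exists k => // i /=; rewrite in_itv/= -ltr_norml.
- exact: measurable_torus_shift.
- move=> ? _ [B mB <-].
  change (lebesgue_rV d (torus_shift a @^-1` rV_box B) =
    lebesgue_rV d (rV_box B)).
  rewrite (_ : torus_shift a @^-1` rV_box B =
    rV_box (fun i => circle_shift (a ord0 i) @^-1` B i)); last first.
    by apply/seteqP; split => x /= h i; have := h i; rewrite /= mxE.
  rewrite !lebesgue_rV_box//; last first.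
    move=> i; rewrite -[X in measurable X]setTI.
    exact: measurable_circle_shift.
  by apply: eq_bigr => i _; rewrite lebesgue_measure_circle_shift.
- move=> ? k.
  change (lebesgue_rV d (torus_shift a @^-1`
    rV_box (fun=> `](- k%:R)%R, k%:R%R[%classic)) < +oo)%E.
  rewrite -ge0_fin_numE//.
  rewrite (_ : torus_shift a @^-1` _ =
    rV_box (fun i => circle_shift (a ord0 i) @^-1`
      `](- k%:R), k%:R[%classic)); last first.
    by apply/seteqP; split => x /= h i; have := h i; rewrite /= mxE.
  rewrite lebesgue_rV_box//; last first.
    move=> i; rewrite -[X in measurable X]setTI.
    exact: measurable_circle_shift.
  apply: (big_ind (fun x : \bar R => x \is a fin_num)) => //.
    by move=> x y; exact: fin_numM.
  move=> i _; rewrite lebesgue_measure_circle_shift//.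
  by rewrite lebesgue_measure_itv/=; case: ifP.
Qed.

Lemma torus_shiftK a : (forall i, 0 <= a ord0 i <= 1) ->
  cancel (torus_shift a) (torus_shift (const_mx 1 - a)).
Proof.
by move=> a01 x; apply/rowP => i; rewrite !mxE circle_shiftK.
Qed.

(** Pulling back a countable measurable cover of [A] gives a cover of the preimage with the same
    total measure. *)
Lemma mu_ext_torus_shift_le a (A : set 'rV[R]_d) :
  (forall i, 0 <= a ord0 i <= 1) ->
  (mu_ext (lebesgue_rV d) (torus_shift a @^-1` A) <=
   mu_ext (lebesgue_rV d) A)%E.
Proof.
move=> a01; apply/le_ereal_inf_tmp => _ [F [mF AF] <-].
apply: ereal_inf_lbound; exists (fun k => torus_shift a @^-1` F k).
  split=> [k|x /AF[k _ Fk]]; last by exists k.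
  by rewrite -[X in measurable X]setTI; exact: measurable_torus_shift.
by apply: eq_eseriesr => k _; rewrite lebesgue_rV_torus_shift.
Qed.

(** The reverse inequality is the previous one for the inverse shift, applied to the preimage of
    [A]. *)
Lemma mu_ext_torus_shift a (A : set 'rV[R]_d) :
  (forall i, 0 <= a ord0 i <= 1) ->
  mu_ext (lebesgue_rV d) (torus_shift a @^-1` A) = mu_ext (lebesgue_rV d) A.
Proof.
move=> a01; apply/eqP; rewrite eq_le mu_ext_torus_shift_le//=.
have b01 i : 0 <= (const_mx 1 - a) ord0 i <= 1.
  by have := a01 i; rewrite !mxE; lra.
have /= := mu_ext_torus_shift_le _ (torus_shift a @^-1` A) b01.
rewrite -comp_preimage
  (_ : torus_shift a \o torus_shift (const_mx 1 - a) = id)//.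
(* Writing [a] as [1 - (1 - a)] turns the right inverse into an instance of the left inverse. *)
apply/funext => x /=; rewrite -[X in torus_shift X](subKr (const_mx 1)).
exact: torus_shiftK.
Qed.

(** A test set [X] is first moved by the shift, that is, pulled back by its inverse; [A] splits the
    result, and the two pieces are pulled back by the shift. No move changes the outer measure. *)
Lemma caratheodory_torus_shift a (A : set 'rV[R]_d) :
  (forall i, 0 <= a ord0 i <= 1) ->
  caratheodory_measurable (mu_ext (lebesgue_rV d)) A ->
  caratheodory_measurable (mu_ext (lebesgue_rV d)) (torus_shift a @^-1` A).
Proof.
move=> a01 mA X.
have b01 i : 0 <= (const_mx 1 - a) ord0 i <= 1.
  by have := a01 i; rewrite !mxE; lra.
have XE B : torus_shift a @^-1` (torus_shift (const_mx 1 - a) @^-1` X `&` B) =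
    X `&` torus_shift a @^-1` B.
  by apply/seteqP; split => x /=; rewrite torus_shiftK.
rewrite -(mu_ext_torus_shift _ X b01) mA -(mu_ext_torus_shift a (_ `&` A) a01).
by rewrite -(mu_ext_torus_shift a (_ `&` ~` A) a01) !XE preimage_setC.
Qed.

Lemma measurable_torus_shift_completed a : (forall i, 0 <= a ord0 i <= 1) ->
  measurable_fun setT
    (torus_shift a : lebesgue_rV_type R d -> lebesgue_rV_type R d).
Proof.
by move=> a01 _ A mA; rewrite setTI; exact: caratheodory_torus_shift.
Qed.

Lemma pushforward_torus_shift a (A : set (lebesgue_rV_type R d)) :
  (forall i, 0 <= a ord0 i <= 1) ->
  pushforward (completed_lebesgue_rV R d)
    (torus_shift a : lebesgue_rV_type R d -> lebesgue_rV_type R d) A =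
  completed_lebesgue_rV R d A.
Proof. by move=> a01; exact: mu_ext_torus_shift. Qed.

End torus_shift.

(** * Translation invariance of the integral over the torus *)

Section torus_translation.
Context {R : realType} {d : nat}.
Implicit Types (a x alpha : 'rV[R]_d) (f g : 'rV[R]_d -> R[i]).
Local Notation mu := (completed_lebesgue_rV R d).
Local Notation cube := (@unit_cube R d).

Lemma measurable_unit_cube : measurable cube.
Proof.
apply: caratheodory_measurable_mu_ext.
exact: (measurable_rV_box (fun=> `[0, 1[%classic)).
Qed.

Lemma completed_lebesgue_rV_unit_cube : mu cube = 1%E.
Proof.
transitivity (lebesgue_rV d (rV_box (fun=> `[0 : R, 1[%classic))).
  have mB : measurable (rV_box (fun=> `[0 : R, 1[%classic) : set 'rV[R]_d).
    exact: measurable_rV_box.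
  exact: (measurable_mu_extE (lebesgue_rV d) mB).
rewrite lebesgue_rV_box// big1// => i _.
by rewrite lebesgue_measure_itv/= lte01 oppr0 adde0.
Qed.

Lemma torus_shift_unit_cube a : (forall i, 0 <= a ord0 i <= 1) ->
  torus_shift a @^-1` cube = cube.
Proof.
move=> a01; apply/seteqP; split => x /= h i; have := h i;
  by rewrite mxE circle_shift_unit.
Qed.

Lemma torus_shift_integral a (h : lebesgue_rV_type R d -> R) :
  (forall i, 0 <= a ord0 i <= 1) ->
  mu.-integrable cube (EFin \o h) ->
  mu.-integrable cube (EFin \o (h \o torus_shift a)) /\
  \int[mu]_(x in cube) h (torus_shift a x) = \int[mu]_(x in cube) h x.
Proof.
move=> a01 ih.
have mC := measurable_unit_cube.
have mS := measurable_torus_shift_completed a a01.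
have SC := torus_shift_unit_cube a a01.
have pushE B : measurable B -> B `<=` cube ->
    pushforward mu
      (torus_shift a : lebesgue_rV_type R d -> lebesgue_rV_type R d) B = mu B.
  by move=> _ _; exact: pushforward_torus_shift.
(* [h] is known to be measurable on the cube only; its extension by zero is measurable everywhere,
   as the change of variables demands. *)
pose g : lebesgue_rV_type R d -> \bar R := (EFin \o h) \_ cube.
have mg : measurable_fun setT g.
  by apply/(measurable_restrictT _ mC); exact: measurable_int ih.
have gS x : x \in cube -> g (torus_shift a x) = (h (torus_shift a x))%:E.
  by rewrite -[in X in X -> _]SC inE /= => Cx; rewrite /g patchE mem_set.
have gE x : x \in cube -> g x = (h x)%:E by move=> Cx; rewrite /g patchE Cx.
(* The change of variables for signed functions presupposes integrability of the composite, which
   comes from the nonnegative version applied to [|g|]. *)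
have igS : mu.-integrable cube (g \o torus_shift a).
  apply/integrableP; split; first exact/measurable_funTS/measurableT_comp.
  have mag : measurable_fun cube (abse \o g).
    by apply: measurable_funTS; exact: measurableT_comp.
  have := @ge0_integral_pushforward _ _ _ _ _ _ mS mu cube (abse \o g) mC mag.
  rewrite SC => /(_ (fun _ _ => abse_ge0 _)) <-.
  rewrite (eq_measure_integral mu pushE); last exact: mS.
  have /integrableP[_] := ih; apply: le_lt_trans; rewrite le_eqVlt.
  by apply/orP; left; apply/eqP/eq_integral => x Cx /=; rewrite gE.
split; first by apply: eq_integrable igS => // x Cx /=; rewrite gS.
rewrite /Rintegral; congr fine.
transitivity (\int[mu]_(x in cube) (g \o torus_shift a) x)%E.
  by apply: eq_integral => x Cx /=; rewrite gS.
have := @integral_pushforward _ _ _ _ _ _ mS mu cube g mg.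
rewrite SC => /(_ igS mC) <-.
rewrite (eq_measure_integral mu pushE); last exact: mS.
by apply: eq_integral => x Cx; exact: gE.
Qed.

Lemma torus_shift_translation alpha : exists2 a : 'rV[R]_d,
  forall i, 0 <= a ord0 i <= 1 &
  forall f, periodic_rV f ->
    {in cube, forall x, f (torus_shift a x) = f (x + alpha)}.
Proof.
(* The rotation parameters are the fractional parts of the coordinates of [alpha]. *)
exists (\row_i (alpha ord0 i - (Num.floor (alpha ord0 i))%:~R)).
  by move=> i; rewrite mxE; have := floor_itv (alpha ord0 i); rewrite intrD; lra.
move=> f pf x /set_mem Cx.
(* The integer vector by which rotation and translation differ: minus the integer part, and one less
   in each coordinate that wraps past 1. *)
pose k : 'rV[int]_d := \row_i
  (- Num.floor (alpha ord0 i) -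
   (1 - (alpha ord0 i - (Num.floor (alpha ord0 i))%:~R) <= x ord0 i)%R%:R).
rewrite -(pf (x + alpha) k); congr (f _).
apply/rowP => i; rewrite !mxE /circle_shift.
have /andP[-> x1] := Cx i; rewrite x1 /= andbT intrB intrN.
rewrite (_ : (0 : 'I_1) = ord0)//.
by case: leP => /= _; rewrite ?mulr0n ?mulr1n ?mulr0z ?mulr1z; lra.
Qed.

Lemma torus_integrable_translation alpha f :
  periodic_rV f -> torus_integrable f ->
  torus_integrable (fun x => f (x + alpha)).
Proof.
move=> pf [iR iI]; have [a a01 aE] := torus_shift_translation alpha.
have [iR' _] := torus_shift_integral a _ a01 iR.
have [iI' _] := torus_shift_integral a _ a01 iI.
split; [apply: eq_integrable iR' | apply: eq_integrable iI'];
  by [exact: measurable_unit_cube|move=> x Cx /=; rewrite aE].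
Qed.

Lemma torus_integral_translation alpha f :
  periodic_rV f -> torus_integrable f ->
  torus_integral (fun x => f (x + alpha)) = torus_integral f.
Proof.
move=> pf [iR iI]; have [a a01 aE] := torus_shift_translation alpha.
have [_ eR] := torus_shift_integral a _ a01 iR.
have [_ eI] := torus_shift_integral a _ a01 iI.
by rewrite /torus_integral -eR -eI; congr (_ +i* _);
  apply: eq_Rintegral => x Cx; rewrite aE.
Qed.

End torus_translation.

(** * Complex modulus and the exponential *)

Section complex_norm.
Context {R : realType}.
Implicit Types (z w : R[i]) (s t : R).

Lemma ReM z w :
  complex.Re (z * w) =
  complex.Re z * complex.Re w - complex.Im z * complex.Im w.
Proof. by case: z w => [a b] [c e]. Qed.

Lemma ImM z w :
  complex.Im (z * w) =
  complex.Re z * complex.Im w + complex.Im z * complex.Re w.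
Proof. by case: z w => [a b] [c e]. Qed.

Lemma ReD z w : complex.Re (z + w) = complex.Re z + complex.Re w.
Proof. by case: z w => [a b] [c e]. Qed.

Lemma ImD z w : complex.Im (z + w) = complex.Im z + complex.Im w.
Proof. by case: z w => [a b] [c e]. Qed.

(** Transfers identities for the [R[i]]-valued norm to the real-valued [normc], by injectivity of
    the embedding of [R]. *)
Lemma normc_normr z : (normc z)%:C = `|z|.
Proof. by rewrite /normc RRe_real// normr_real. Qed.

Lemma normcM z w : normc (z * w) = normc z * normc w.
Proof. by apply: complexI; rewrite rmorphM/= !normc_normr normrM. Qed.

Lemma normc_ge0 z : 0 <= normc z.
Proof. by rewrite -lecR normc_normr normr_ge0. Qed.

Lemma Re_le_normc z : complex.Re z <= normc z.
Proof.
by apply: (le_trans (ler_norm _)); rewrite -lecR normc_normr normc_ge_Re.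
Qed.

Lemma expi2piD s t : expi2pi (s + t) = expi2pi s * expi2pi t.
Proof.
apply/eqP; rewrite eq_complex ReM ImM /expi2pi/= mulrDr cosD sinD.
by apply/andP; split => //; rewrite [X in _ == X]addrC.
Qed.

Lemma expi2pi0 : expi2pi 0 = 1 :> R[i].
Proof. by rewrite /expi2pi mulr0 cos0 sin0. Qed.

Lemma expi2pi1 : expi2pi 1 = 1 :> R[i].
Proof. by rewrite /expi2pi mulr1 mulr_natl cos2pi sin2pi. Qed.

Lemma expi2pi_half : expi2pi 2^-1 = -1 :> R[i].
Proof.
rewrite /expi2pi mulrAC divff// mul1r cospi sinpi.
by apply/eqP; rewrite eq_complex/= oppr0 !eqxx.
Qed.

Lemma expi2piN t : expi2pi (- t) * expi2pi t = 1.
Proof. by rewrite -expi2piD addNr expi2pi0. Qed.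

Lemma expi2pi_int (k : int) : expi2pi k%:~R = 1 :> R[i].
Proof.
have nat1 n : expi2pi n%:R = 1 :> R[i].
  elim: n => [|n IH]; first exact: expi2pi0.
  by rewrite -natr1 expi2piD IH expi2pi1 mul1r.
case: k => n; first exact: nat1.
by rewrite NegzE intrN -[LHS]mulr1 -(nat1 n.+1) expi2piN.
Qed.

Lemma normc_expi2pi t : normc (expi2pi t) = 1.
Proof. by rewrite /normc normc_def /expi2pi/= cos2Dsin2 sqrtr1. Qed.

End complex_norm.

(** * Characters of the torus *)

Section int_dot.
Context {R : realType} {d : nat}.
Implicit Types (m : 'rV[int]_d) (x y : 'rV[R]_d).

Lemma int_dotD m x y : int_dot m (x + y) = int_dot m x + int_dot m y.
Proof. by rewrite -big_split/=; apply: eq_bigr => i _; rewrite mxE mulrDr. Qed.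

Lemma int_dotZ m (c : R) x : int_dot m (c *: x) = c * int_dot m x.
Proof. by rewrite mulr_sumr; apply: eq_bigr => i _; rewrite mxE mulrCA. Qed.

(** An integer translation changes the phase by an integer, where the exponential is 1. *)
Lemma expi2pi_dot_periodic m : periodic_rV (fun x => expi2pi (- int_dot m x)).
Proof.
move=> x k; rewrite int_dotD opprD expi2piD.
rewrite [X in _ * expi2pi (- X)](_ : _ =
    (\sum_(i < d) m ord0 i * k ord0 i)%:~R); last first.
  by rewrite /int_dot rmorph_sum/=; apply: eq_bigr => i _; rewrite mxE intrM.
by rewrite -intrN expi2pi_int mulr1.
Qed.

Lemma int_dot_surj m (t : R) : m != 0 -> exists x, int_dot m x = t.
Proof.
move=> m0; have [i mi0] : exists i, m ord0 i != 0.
  apply/existsP; apply: contraNT m0; rewrite negb_exists => /forallP m0.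
  by apply/eqP/rowP => i; have := m0 i; rewrite negbK mxE => /eqP.
(* A vector supported on one coordinate where [m] does not vanish. *)
exists (t / (m ord0 i)%:~R *: delta_mx 0 i); rewrite int_dotZ /int_dot.
rewrite (bigD1 i)//= big1 ?addr0 => [|j ji].
  by rewrite mxE !eqxx mulr1 divfK// intr_eq0.
by rewrite mxE (negbTE ji) andbF mulr0.
Qed.

Lemma measurable_int_dot m :
  measurable_fun setT (fun x : 'rV[R]_d => int_dot m x).
Proof.
apply: measurable_sum => i; apply: measurable_funM => //.
exact: measurable_coord_rV.
Qed.

Lemma measurable_fun_completed (h : 'rV[R]_d -> R) :
  measurable_fun setT h ->
  measurable_fun setT (h : lebesgue_rV_type R d -> R).
Proof.
move=> mh _ Y mY; rewrite setTI; apply: caratheodory_measurable_mu_ext.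
by rewrite -[X in measurable X]setTI; exact: mh.
Qed.

Lemma measurable_expi2pi_dot m :
  measurable_fun setT (fun x : lebesgue_rV_type R d =>
    complex.Re (expi2pi (- int_dot m x))) /\
  measurable_fun setT (fun x : lebesgue_rV_type R d =>
    complex.Im (expi2pi (- int_dot m x))).
Proof.
have marg : measurable_fun setT (fun x : 'rV[R]_d => 2 * pi * - int_dot m x).
  apply: measurable_funM => //; apply: measurable_funN.
  exact: measurable_int_dot.
split; apply: measurable_fun_completed.
- apply: measurableT_comp marg.
  exact: continuous_measurable_fun (@continuous_cos R).
- apply: measurableT_comp marg.
  exact: continuous_measurable_fun (@continuous_sin R).
Qed.

End int_dot.

(** * Linearity of the integral, integrals of characters and the norm bound *)

Section torus_integral_theory.
Context {R : realType} {d : nat}.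
Implicit Types (f g : 'rV[R]_d -> R[i]) (c : R[i]) (m : 'rV[int]_d).
Local Notation mu := (completed_lebesgue_rV R d).
Local Notation cube := (@unit_cube R d).

Let mC := @measurable_unit_cube R d.

Lemma torus_integrable0 : torus_integrable (fun _ : 'rV[R]_d => 0).
Proof. by split; exact: integrable0. Qed.

Lemma torus_integral0 : torus_integral (fun _ : 'rV[R]_d => 0) = 0.
Proof.
by rewrite /torus_integral !Rintegral_cst// !mul0r.
Qed.

Lemma torus_integrableD f g : torus_integrable f -> torus_integrable g ->
  torus_integrable (fun x => f x + g x).
Proof.
move=> [fR fI] [gR gI]; split.
- apply: eq_integrable (integrableD mC fR gR) => // x _ /=.
  by rewrite ReD EFinD.
- apply: eq_integrable (integrableD mC fI gI) => // x _ /=.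
  by rewrite ImD EFinD.
Qed.

Lemma torus_integralD f g : torus_integrable f -> torus_integrable g ->
  torus_integral (fun x => f x + g x) = torus_integral f + torus_integral g.
Proof.
move=> [fR fI] [gR gI]; apply/eqP; rewrite eq_complex ReD ImD /=.
rewrite -!RintegralD//; apply/andP; split; apply/eqP;
  by apply: eq_Rintegral => x _; rewrite ?ReD ?ImD.
Qed.

Lemma torus_integrableZ c f :
  torus_integrable f -> torus_integrable (fun x => c * f x).
Proof.
move=> [fR fI]; split.
- apply: eq_integrable (integrableB mC (integrableZl mC (complex.Re c) fR)
    (integrableZl mC (complex.Im c) fI)) => // x _ /=.
  by rewrite ReM EFinB !EFinM.
- apply: eq_integrable (integrableD mC (integrableZl mC (complex.Re c) fI)
    (integrableZl mC (complex.Im c) fR)) => // x _ /=.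
  by rewrite ImM EFinD !EFinM.
Qed.

Lemma torus_integralZ c f : torus_integrable f ->
  torus_integral (fun x => c * f x) = c * torus_integral f.
Proof.
move=> [fR fI].
have ZR (r : R) (h : lebesgue_rV_type R d -> R) :
    mu.-integrable cube (EFin \o h) ->
    mu.-integrable cube (EFin \o (fun x => r * h x)).
  by move=> hi; exact: (integrableZl mC r hi).
apply/eqP; rewrite eq_complex ReM ImM /=.
rewrite -!RintegralZl// -RintegralB//; [|exact: ZR..].
rewrite -RintegralD//; [|exact: ZR..].
by apply/andP; split; apply/eqP; apply: eq_Rintegral => x _; rewrite ?ReM ?ImM.
Qed.

Lemma torus_integrable_sum (I : Type) (s : seq I) (F : I -> 'rV[R]_d -> R[i]) :
  (forall i, torus_integrable (F i)) ->
  torus_integrable (fun x => \sum_(i <- s) F i x).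
Proof.
move=> iF; elim: s => [|i s IH].
  by under eq_fun do rewrite big_nil; exact: torus_integrable0.
by under eq_fun do rewrite big_cons; exact: torus_integrableD.
Qed.

Lemma torus_integral_sum (I : Type) (s : seq I) (F : I -> 'rV[R]_d -> R[i]) :
  (forall i, torus_integrable (F i)) ->
  torus_integral (fun x => \sum_(i <- s) F i x) =
  \sum_(i <- s) torus_integral (F i).
Proof.
move=> iF; elim: s => [|i s IH].
  by under eq_fun do rewrite big_nil; rewrite torus_integral0 big_nil.
under eq_fun do rewrite big_cons.
by rewrite big_cons torus_integralD ?IH//; exact: torus_integrable_sum.
Qed.

Lemma torus_integrable_character m :
  torus_integrable (fun x : 'rV[R]_d => expi2pi (- int_dot m x)).
Proof.
have [mR mI] := @measurable_expi2pi_dot R d m.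
have cubey : (mu cube < +oo)%E by rewrite completed_lebesgue_rV_unit_cube ltry.
split.
- apply: (measurable_bounded_integrable mC cubey (measurable_funTS mR)).
  by exists 1; split => // M M1 x _; apply: (le_trans (cos_max _)); exact: ltW.
- apply: (measurable_bounded_integrable mC cubey (measurable_funTS mI)).
  by exists 1; split => // M M1 x _; apply: (le_trans (sin_max _)); exact: ltW.
Qed.

(** The real and imaginary parts of the character are measurable and bounded by 1, so multiplying by
    them preserves integrability. *)
Lemma torus_integrable_mul_character m f : torus_integrable f ->
  torus_integrable (fun x => f x * expi2pi (- int_dot m x)).
Proof.
move=> [fR fI]; have [mR mI] := @measurable_expi2pi_dot R d m.
have mulR h : mu.-integrable cube (EFin \o h) ->
    mu.-integrable cube (fun x =>
      (h x * complex.Re (expi2pi (- int_dot m x)))%:E).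
  move=> ih; apply: (integrableMl mC ih); first exact: measurable_funTS.
  by exists 1; split => // M M1 x _; apply: (le_trans (cos_max _)); exact: ltW.
have mulI h : mu.-integrable cube (EFin \o h) ->
    mu.-integrable cube (fun x =>
      (h x * complex.Im (expi2pi (- int_dot m x)))%:E).
  move=> ih; apply: (integrableMl mC ih); first exact: measurable_funTS.
  by exists 1; split => // M M1 x _; apply: (le_trans (sin_max _)); exact: ltW.
split.
- apply: eq_integrable (integrableB mC (mulR _ fR) (mulI _ fI)) => // x _ /=.
  by rewrite ReM EFinB.
- apply: eq_integrable (integrableD mC (mulR _ fI) (mulI _ fR)) => // x _ /=.
  by rewrite ImM EFinD addeC.
Qed.

(* Translating by [b] with [m . b = 1/2] changes the sign of the character. *)
Lemma torus_integral_character m : m != 0 ->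
  torus_integral (fun x : 'rV[R]_d => expi2pi (- int_dot m x)) = 0.
Proof.
move=> m0; have [b mb] := int_dot_surj m (- 2^-1 : R) m0.
have := torus_integral_translation b _ (expi2pi_dot_periodic m)
  (torus_integrable_character m).
under eq_fun do rewrite int_dotD opprD expi2piD mb opprK expi2pi_half mulrC.
rewrite torus_integralZ ?mulN1r; last exact: torus_integrable_character.
by move=> /eqP; rewrite eq_sym -subr_eq0 opprK -mulr2n mulrn_eq0/= => /eqP.
Qed.

Lemma normc_torus_integral_le f (M : R) : torus_integrable f ->
  (forall x, normc (f x) <= M) -> normc (torus_integral f) <= M.
Proof.
(* The rotating factor divides by the integral, so the zero case is separate; there [M] is
   nonnegative because it bounds a norm. *)
move=> fi fM; have [I0|I0] := eqVneq (torus_integral f) 0.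
  have -> : normc (torus_integral f) = 0.
    by apply: complexI; rewrite normc_normr I0 normr0.
  exact: le_trans (normc_ge0 _) (fM 0).
(* Rotate [f] so that its integral becomes a nonnegative real. *)
pose c := `|torus_integral f| / torus_integral f.
have c1 : normc c = 1.
  by apply: complexI; rewrite normc_normr normrM normfV normr_id divff// normr_eq0.
have cI : c * torus_integral f = (normc (torus_integral f))%:C.
  by rewrite normc_normr divfK.
have [cR _] := torus_integrableZ c f fi.
have -> : normc (torus_integral f) =
    \int[mu]_(x in cube) complex.Re (c * f x).
  have := torus_integralZ c f fi; rewrite cI => /(congr1 (@complex.Re R)).
  by move=> /= <-.
have iM : mu.-integrable cube (EFin \o cst M).
  apply: measurable_bounded_integrable => //.
    by rewrite completed_lebesgue_rV_unit_cube ltry.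
  by exists `|M|; split => // N MN x _; exact: ltW.
(* The cube has measure 1, so [M] is the integral of the constant [M], and monotonicity of the real
   integral applies. *)
rewrite -[leRHS]mulr1 -[X in _ * X]/(fine 1%E).
rewrite -(@completed_lebesgue_rV_unit_cube R d).
rewrite -Rintegral_cst//; apply: le_Rintegral => // x _.
by rewrite (le_trans (Re_le_normc _))// normcM c1 mul1r.
Qed.

End torus_integral_theory.

(** * Fourier coefficients of the discrepancy *)

(** The list depends on the bound alone: one finite index set serves all points [x] at once, which
    lets the sum be exchanged with the integral. *)
Lemma fsbig_bounded_support (V : nmodType) (M : int) : exists s : seq int,
  forall F : int -> V, (forall n, M < `|n| -> F n = 0) ->
  \sum_(n \in [set: int]) F n = \sum_(n <- s) F n.
Proof.
(* [Negz k] is [-(k + 1)], so the two halves cover every integer of absolute value at most [M]. *)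
pose s := [seq Posz k | k <- iota 0 `|M|.+1] ++
  [seq Negz k | k <- iota 0 `|M|.+1].
exists (undup s) => F F0; rewrite [RHS]fsbig_seq ?undup_uniq//.
apply/esym/fsbig_widen => // n [_ /= ns]; apply: F0; rewrite ltNge.
apply: contra_notN ns => nM.
rewrite -[_ \in _]/(n \in undup s) mem_undup mem_cat.
case: n nM => k kM; apply/orP; [left|right]; apply/map_f;
  rewrite mem_iota/=; lia.
Qed.

Section discrepancy.
Context {R : realType} {d : nat}.
Implicit Types (f : 'rV[R]_d -> R[i]) (alpha : 'rV[R]_d) (m : 'rV[int]_d).

(** Integrability of the product is established alongside, because bounding its integral by the
    supremum calls for it. *)
Lemma fourier_coef_discrepancy (Phi : nat -> int -> R[i]) (N : nat) f m alpha :
  (exists M : int, forall n : int, M < `|n| -> Phi N n = 0) ->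
  periodic_rV f -> torus_integrable f -> m != 0 ->
  torus_integrable (fun x =>
    discrepancy Phi alpha f N x * expi2pi (- int_dot m x)) /\
  fourier_coef (discrepancy Phi alpha f N) m =
  (\sum_(n \in [set: int]) Phi N n * expi2pi (n%:~R * int_dot m alpha)) *
    fourier_coef f m.
Proof.
move=> [M PhiM] pf fi m0.
pose e (x : 'rV[R]_d) : R[i] := expi2pi (- int_dot m x).
have [s sE] := fsbig_bounded_support R[i] M.
pose F x := f x * e x.
have pF : periodic_rV F by move=> x k; rewrite /F pf /e expi2pi_dot_periodic.
have iF : torus_integrable F := torus_integrable_mul_character m f fi.
have ie : torus_integrable e := torus_integrable_character m.
have iFn (n : int) : torus_integrable (fun x =>
    Phi N n * expi2pi (n%:~R * int_dot m alpha) * F (x + n%:~R *: alpha)).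
  exact/torus_integrableZ/torus_integrable_translation.
(* The exponential weight cancels the phase that the character gains under translation by [n alpha];
   every term thus becomes a multiple of a translate of the single function [F]. *)
have E x : discrepancy Phi alpha f N x * e x =
    \sum_(n <- s) Phi N n * expi2pi (n%:~R * int_dot m alpha) *
      F (x + n%:~R *: alpha) + (- torus_integral f) * e x.
  rewrite /discrepancy mulrBl mulNr; congr (_ - _).
  rewrite sE => [|n nM]; last by rewrite PhiM// mul0r.
  rewrite mulr_suml; apply: eq_bigr => n _.
  rewrite /F /e int_dotD int_dotZ opprD expi2piD.
  rewrite -[LHS]mulr1 -(expi2piN (n%:~R * int_dot m alpha)); ring.
have iS := torus_integrable_sum int s _ iFn.
have iT := torus_integrableZ (- torus_integral f) e ie.
split; first by under eq_fun do rewrite E; exact: torus_integrableD.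
rewrite {1}/fourier_coef; under eq_fun do rewrite -/(e _) E.
rewrite torus_integralD// torus_integralZ// torus_integral_character//.
rewrite mulr0 addr0.
rewrite torus_integral_sum// sE => [|n nM]; last by rewrite PhiM// mul0r.
rewrite mulr_suml; apply: eq_bigr => n _.
rewrite torus_integralZ; last exact: torus_integrable_translation.
by rewrite torus_integral_translation.
Qed.

Lemma weight_discrepancy_le (Phi : nat -> int -> R[i]) (N : nat) f m alpha :
  (exists M : int, forall n : int, M < `|n| -> Phi N n = 0) ->
  periodic_rV f -> torus_integrable f -> m != 0 ->
  ((normc (\sum_(n \in [set: int])
      Phi N n * expi2pi (n%:~R * int_dot m alpha)) *
    normc (fourier_coef f m))%:E <=
  ereal_sup [set (normc (discrepancy Phi alpha f N x))%:E | x in setT])%E.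
Proof.
move=> PhiN pf fi m0.
have [iD DE] := fourier_coef_discrepancy Phi N f m alpha PhiN pf fi m0.
have ub x : ((normc (discrepancy Phi alpha f N x))%:E <=
  ereal_sup [set (normc (discrepancy Phi alpha f N x))%:E | x in setT])%E.
  by apply: ereal_sup_ubound; exists x.
(* An infinite supremum makes the bound trivial, and [-oo] is excluded by the value at the point 0;
   a finite one is a uniform bound on the discrepancy. *)
move: ub; case: (ereal_sup _) => [r| |] ub; last 2 first.
- exact: leey.
- by have := ub 0; rewrite leeNy_eq.
rewrite lee_fin -normcM -DE; apply: normc_torus_integral_le => // x.
by rewrite normcM normc_expi2pi mulr1 -lee_fin.
Qed.

End discrepancy.

(** * Passage to the upper limit *)

(** The upper limit is the limit of the tail suprema, and a finite nonnegative factor passes through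
    both operations, even at infinite values, with [+oo * 0 = 0]. *)
Lemma limn_esupM_le (R : realType) (u v : (\bar R)^nat) (c : R) (n0 : nat) :
  0 <= c -> (forall n, (n0 <= n)%N -> u n * c%:E <= v n)%E ->
  (limn_esup u * c%:E <= limn_esup v)%E.
Proof.
move=> c0 uv; rewrite !limn_esup_lim -limeMr//; last exact: is_cvg_esups.
apply: lee_lim; [exact/is_cvgeZr/is_cvg_esups|exact: is_cvg_esups|].
(* Taking the factor out of the supremum needs a nonempty tail; it contains [u n]. *)
exists n0 => // n /= n0n; rewrite muleC /esups -ereal_supZl//; last first.
  by apply/set0P; exists (u n), n => /=.
apply: ge_ereal_sup => _ [_ [k /= nk <-] <-]; rewrite muleC.
apply: le_trans (uv k (leq_trans n0n nk)) _.
by apply: ereal_sup_ubound; exists k.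
Qed.

Theorem theorem1p3 (R : realType) (d : nat) (theta : R)
    (Phi : nat -> int -> R[i]) :
  (0 < d)%N ->
  0 < theta ->
  (forall N : nat, (0 < N)%N ->
     exists M : int, forall n : int, M < `|n| -> Phi N n = 0) ->
  (forall N : nat, (0 < N)%N -> \sum_(n \in [set: int]) Phi N n = 1) ->
  forall f : 'rV[R]_d -> R[i], periodic_rV f -> torus_integrable f ->
  forall (m : 'rV[int]_d) (alpha : 'rV[R]_d), m != 0 ->
  (weight_limsup Phi theta (int_dot m alpha) * (normc (fourier_coef f m))%:E
     <= discrepancy_limsup Phi theta alpha f)%E.
Proof.
move=> _ _ PhiM _ f pf fi m alpha m0.
(* The weights are constrained from [N = 1] on, and the term at [N = 0] does not affect the upper
   limits. *)
apply: (limn_esupM_le _ _ _ _ 1%N); first exact: normc_ge0.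
move=> N N1; rewrite -EFinM -mulrA EFinM lee_wpmul2l ?lee_fin ?powR_ge0//.
by apply: weight_discrepancy_le => //; exact: PhiM.
Qed.
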